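(* Let $A$ be a unital bornological algebra. Let $\mathfrak T\subseteq\mathrm{Ho}(A)$ be a triangulated subcategory that contains $\mathrm{Mod}(A)$. If $\mathfrak T$ is closed under direct sums or under direct products, then $\mathfrak T=\mathrm{Ho}(A)$.
   Context: All bornological vector spaces are complete and convex over $\mathbb C$ (every bounded subset is contained in a bounded absolutely convex $T$ whose span is a Banach space with closed unit ball $T$). $\mathrm{Mod}(A)$ is the category of bornological left $A$-modules (unital modules with a bounded bilinear action) and bounded $A$-module homomorphisms; it is additive and has kernels, cokernels, arbitrary direct sums and direct products. $\mathrm{Ho}(A)$ is the homotopy category of (unbounded) chain complexes over $\mathrm{Mod}(A)$: morphisms are homotopy classes of chain maps, with bounded $A$-linear chain maps and homotopies. It is triangulated, with translation functor $\Sigma$ and exact triangles those isomorphic to mapping cone triangles; direct sums and products are formed degreewise. $\mathrm{Mod}(A)$ is embedded in $\mathrm{Ho}(A)$ as the complexes concentrated in degree $0$. A triangulated subcategory is a full subcategory closed under isomorphism, under $\Sigma^{\pm1}$, and such that if two objects of an exact triangle belong to it so does the third. *)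

(* Defs.v *)
From HB Require Import structures.
From mathcomp Require Import all_boot all_order all_algebra.
From mathcomp Require Import complex.
From mathcomp Require Import all_classical all_reals.

Set Implicit Arguments.
Unset Strict Implicit.
Unset Printing Implicit Defensive.

Import Order.TTheory GRing.Theory Num.Theory.
Local Open Scope classical_set_scope.
Local Open Scope ring_scope.

Definition dprod (K : pzRingType) (I : Type) (V : I -> lmodType K) : Type :=
  forall i, V i.

Section DprodLmod.
Context (K : pzRingType) (I : Type) (V : I -> lmodType K).
Implicit Types f g h : dprod V.

HB.instance Definition _ := gen_eqMixin (dprod V).
HB.instance Definition _ := gen_choiceMixin (dprod V).

Definition dprod_zero : dprod V := fun=> 0.
Definition dprod_opp f : dprod V := fun i => - f i.
Definition dprod_add f g : dprod V := fun i => f i + g i.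
Definition dprod_scale (a : K) f : dprod V := fun i => a *: f i.

Fact dprod_addA : associative dprod_add.
Proof. by move=> f g h; apply/functional_extensionality_dep => i; exact: addrA. Qed.
Fact dprod_addC : commutative dprod_add.
Proof. by move=> f g; apply/functional_extensionality_dep => i; exact: addrC. Qed.
Fact dprod_add0 : left_id dprod_zero dprod_add.
Proof. by move=> f; apply/functional_extensionality_dep => i; exact: add0r. Qed.
Fact dprod_addN : left_inverse dprod_zero dprod_opp dprod_add.
Proof. by move=> f; apply/functional_extensionality_dep => i; exact: addNr. Qed.

HB.instance Definition _ := GRing.isZmodule.Build (dprod V)
  dprod_addA dprod_addC dprod_add0 dprod_addN.

Fact dprod_scaleA a b f : dprod_scale a (dprod_scale b f) = dprod_scale (a * b) f.
Proof. by apply/functional_extensionality_dep => i; exact: scalerA. Qed.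
Fact dprod_scale1 : left_id 1 dprod_scale.
Proof. by move=> f; apply/functional_extensionality_dep => i; exact: scale1r. Qed.
Fact dprod_scaleDr : right_distributive dprod_scale +%R.
Proof. by move=> a f g; apply/functional_extensionality_dep => i; exact: scalerDr. Qed.
Fact dprod_scaleDl f : {morph dprod_scale^~ f : a b / a + b}.
Proof. by move=> a b; apply/functional_extensionality_dep => i; exact: scalerDl. Qed.

HB.instance Definition _ := GRing.Zmodule_isLmodule.Build K (dprod V)
  dprod_scaleA dprod_scale1 dprod_scaleDr dprod_scaleDl.

Definition dprod_proj (i : I) f : V i := f i.

Fact dprod_proj_linear i : linear (dprod_proj i).
Proof. by []. Qed.

HB.instance Definition _ i :=
  GRing.isLinear.Build K (dprod V) (V i) *:%R (dprod_proj i) (dprod_proj_linear i).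

Definition finsupp : {pred dprod V} :=
  fun f => `[< finite_set [set i | f i != 0] >].

Fact finsupp_submod : submod_closed finsupp.
Proof.
split=> [|a f g]; rewrite /in_mem /=.
  by apply/asboolP; rewrite (_ : [set _ | _] = set0) //;
    apply/seteqP; split=> i //=; rewrite eqxx.
move=> /asboolP ff /asboolP fg; apply/asboolP.
apply: (@sub_finite_set _ _ ([set i | f i != 0] `|` [set i | g i != 0])).
  move=> i /= afg; have [fi0|fi] := eqVneq (f i) 0; last by left.
  right; apply: contra_neq afg => gi0.
  by rewrite (_ : (a *: f + g) i = a *: f i + g i) // fi0 gi0 scaler0 addr0.
by rewrite finite_setU.
Qed.

HB.instance Definition _ :=
  GRing.isSubmodClosed.Build K (dprod V) finsupp finsupp_submod.

Record dsum := DSum { dsum_fun :> dprod V; dsum_finsupp : dsum_fun \in finsupp }.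

HB.instance Definition _ := [isSub for dsum_fun].
HB.instance Definition _ := [Choice of dsum by <:].
HB.instance Definition _ := [SubChoice_isSubLmodule of dsum by <:].

Definition dsum_proj (i : I) (f : dsum) : V i := dsum_fun f i.

Fact dsum_proj_linear i : linear (dsum_proj i).
Proof. by []. Qed.

HB.instance Definition _ i :=
  GRing.isLinear.Build K dsum (V i) *:%R (dsum_proj i) (dsum_proj_linear i).

End DprodLmod.
Arguments dprod_proj {K I V} i f.
Arguments dsum_proj {K I V} i f.

Section Bornology.
Context (R : realType).
Local Notation C := (R[i]).
Local Notation normc := (@ComplexField.Normc.normc R).

Section Disks.
Context (V : lmodType C).
Implicit Types (S T W : set V) (N : V -> R).

Definition linear_span T : set V :=
  [set x | exists n (a : 'I_n -> C) (t : 'I_n -> V),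
    (forall k, T (t k)) /\ x = \sum_k a k *: t k].

Definition norm_on W N : Prop :=
  [/\ forall x, W x -> 0 <= N x,
      forall x, W x -> N x = 0 -> x = 0,
      forall x y, W x -> W y -> N (x + y) <= N x + N y
    & forall a x, W x -> N (a *: x) = normc a * N x].

Definition cauchy_for N (u : nat -> V) : Prop :=
  forall e : R, 0 < e ->
    exists k, forall m n, (k <= m)%N -> (k <= n)%N -> N (u m - u n) < e.

Definition converges_for N (u : nat -> V) (l : V) : Prop :=
  forall e : R, 0 < e -> exists k, forall n, (k <= n)%N -> N (u n - l) < e.

Definition banach_on W N : Prop :=
  norm_on W N /\
  forall u : nat -> V, (forall n, W (u n)) -> cauchy_for N u ->
    exists2 l, W l & converges_for N u l.

Definition absolutely_convex T : Prop :=
  forall (a b : C) x y, normc a + normc b <= 1 -> T x -> T y ->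
    T (a *: x + b *: y).

Definition banach_disk T : Prop :=
  absolutely_convex T /\
  exists N, banach_on (linear_span T) N /\
    T = [set x | linear_span T x /\ N x <= 1].

Record complete_bornology (B : set (set V)) : Prop := CompleteBornology {
  born_sub : forall S T, S `<=` T -> B T -> B S;
  born_point : forall x, B [set x];
  born_union : forall S T, B S -> B T -> B (S `|` T);
  born_add : forall S T, B S -> B T -> B [set x + y | x in S & y in T];
  born_scale : forall (r : R) S, B S ->
    B [set a *: x | a in [set a | normc a <= r] & x in S];
  born_disk : forall S, B S -> exists T, [/\ B T, S `<=` T & banach_disk T] }.

Lemma linear_span_sub T : T `<=` linear_span T.
Proof.
move=> x Tx; exists 1, (fun=> 1), (fun=> x); split=> //.
by rewrite big_ord1 scale1r.
Qed.

Lemma linear_spanD T x y :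
  linear_span T x -> linear_span T y -> linear_span T (x + y).
Proof.
move=> [n [a [t [Tt ->]]]] [m [b [s [Ts ->]]]].
pose c (k : 'I_(n + m)) :=
  match fintype.split k with inl i => a i | inr i => b i end.
pose r (k : 'I_(n + m)) :=
  match fintype.split k with inl i => t i | inr i => s i end.
exists (n + m)%N, c, r; split.
  by rewrite /r => k; case: (fintype.split k).
rewrite big_split_ord /=; congr (_ + _); apply: eq_bigr => i _; rewrite /c /r.
  by have /= -> := unsplitK (inl i : 'I_n + 'I_m).
by have /= -> := unsplitK (inr i : 'I_n + 'I_m).
Qed.

Lemma linear_spanZ T a x : linear_span T x -> linear_span T (a *: x).
Proof.
move=> [n [b [t [Tt ->]]]]; exists n, (fun k => a * b k), t; split=> //.
by rewrite scaler_sumr; apply: eq_bigr => k _; rewrite scalerA.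
Qed.

Lemma linear_spanB T x y :
  linear_span T x -> linear_span T y -> linear_span T (x - y).
Proof.
by move=> Tx Ty; rewrite -scaleN1r; apply: linear_spanD => //;
  exact: linear_spanZ.
Qed.

Lemma linear_span_set0 x : linear_span [set 0] x -> x = 0.
Proof.
move=> [n [b [t [Tt ->]]]]; rewrite big1 // => k _.
by rewrite (Tt k) scaler0.
Qed.

Lemma banach_disk0 : banach_disk [set 0].
Proof.
have s0 : linear_span [set (0 : V)] = [set 0].
  by apply/seteqP; split=> [x /linear_span_set0 //|]; exact: linear_span_sub.
split; first by move=> a b x y _ -> ->; rewrite !scaler0 addr0.
exists (fun=> 0); split; last first.
  rewrite s0; apply/seteqP; split=> [x x0|x []//]; split=> //; exact: ler01.
rewrite s0; split.
  by split=> // [x y|a x] *; rewrite ?addr0 ?mulr0.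
by move=> u _ _; exists 0 => // e e0; exists 0%N.
Qed.

End Disks.

Lemma normc_ge0 (a : C) : 0 <= normc a.
Proof. by rewrite /ComplexField.Normc.normc; case: a => x y; exact: sqrtr_ge0. Qed.

Section FamilyBornology.
Context (I : Type) (V : I -> lmodType C) (W : lmodType C).
Context (p : forall i, {linear W -> V i}).
Hypothesis p_inj : forall x, (forall i, p i x = 0) -> x = 0.

Lemma linear_span_image (U U' : lmodType C) (f : {linear U -> U'})
    (T : set U) (T' : set U') x :
  (forall y, T y -> T' (f y)) -> linear_span T x -> linear_span T' (f x).
Proof.
move=> TT' [n [a [t [Tt ->]]]]; exists n, a, (fun k => f (t k)).
split=> [k|]; first exact: TT'.
by rewrite linear_sum; apply: eq_bigr => k _; rewrite linearZ.
Qed.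

Lemma banach_disk_family (T : forall i, set (V i)) :
  (forall i, banach_disk (T i)) ->
  (forall l : forall i, V i, (forall i, linear_span (T i) (l i)) ->
     exists w, forall i, p i w = l i) ->
  banach_disk [set w | forall i, T i (p i w)].
Proof.
move=> bT lift; set D := [set w | _]; split.
  move=> a b x y ab Dx Dy i; rewrite linearD !linearZ.
  by apply: (bT i).1.
have /(_ _)/cid Nx i := (bT i).2.
pose N i := projT1 (Nx i).
have bN i : banach_on (linear_span (T i)) (N i) by have [] := projT2 (Nx i).
have TE i : T i = [set x | linear_span (T i) x /\ N i x <= 1].
  by have [] := projT2 (Nx i).
have N0 i x : linear_span (T i) x -> 0 <= N i x by have [[]] := bN i; auto.
have Nd i x : linear_span (T i) x -> N i x = 0 -> x = 0.
  by have [[]] := bN i; auto.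
have ND i x y : linear_span (T i) x -> linear_span (T i) y ->
  N i (x + y) <= N i x + N i y by have [[]] := bN i; auto.
have NZ i a x : linear_span (T i) x -> N i (a *: x) = normc a * N i x.
  by have [[]] := bN i; auto.
have pD i x : linear_span D x -> linear_span (T i) (p i x).
  by apply: linear_span_image => y; apply.
have bd x : linear_span D x -> exists c, forall i, N i (p i x) <= c.
  move=> [n [a [t [Dt ->]]]]; exists (\sum_k normc (a k)) => i.
  have st k : linear_span (T i) (p i (t k)) by apply/linear_span_sub/Dt.
  have sp J : linear_span (T i) (\sum_(k <- J) a k *: p i (t k)).
    elim: J => [|k J IH]; rewrite (big_nil, big_cons).
      by exists 0%N, (fun=> 0), (fun=> 0); split=> [[]//|]; rewrite big_ord0.
    by apply: linear_spanD => //; exact: linear_spanZ.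
  rewrite linear_sum; under eq_bigr do rewrite linearZ.
  elim: (index_enum _) => [|k J IH]; rewrite ?(big_nil, big_cons).
    have -> : 0 = (0 : C) *: (0 : V i) by rewrite scale0r.
    rewrite NZ ?ComplexField.Normc.normc0 ?mul0r//.
    by have := sp [::]; rewrite big_nil.
  apply: le_trans (ND _ _ _ _ _) _ => //; first exact: linear_spanZ.
  apply: lerD => //; rewrite NZ // -[leRHS]mulr1 ler_wpM2l ?normc_ge0//.
  by have := Dt k i; rewrite TE => -[].
pose M x := sup (0 |` [set r | exists i, r = N i (p i x)]).
have hsM x : linear_span D x ->
    has_sup (0 |` [set r | exists i, r = N i (p i x)]).
  move=> /bd [c cP]; split; first by exists 0; left.
  exists (Num.max 0 c) => r [->|[i ->]]; rewrite le_max ?lexx ?cP ?orbT//.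
have M0 x : linear_span D x -> 0 <= M x.
  by move=> Dx; apply: ub_le_sup; [have [] := hsM x Dx|left].
have NM i x : linear_span D x -> N i (p i x) <= M x.
  by move=> Dx; apply: ub_le_sup; [have [] := hsM x Dx|right; exists i].
have Mle x c : 0 <= c -> (forall i, N i (p i x) <= c) -> M x <= c.
  move=> c0 cP; apply: ge_sup; first by exists 0; left.
  by move=> r [->|[i ->]].
have MZle a x : linear_span D x -> M (a *: x) <= normc a * M x.
  move=> Dx; apply: Mle => [|i]; first by rewrite mulr_ge0 ?normc_ge0 ?M0.
  rewrite linearZ_LR NZ; last exact: pD. by rewrite ler_wpM2l ?normc_ge0 ?NM.
exists M; split; last first.
  apply/seteqP; split=> x.
    move=> Dx; split; first exact: linear_span_sub.
    by apply: Mle => // i; have := Dx i; rewrite TE => -[].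
  move=> [Dx Mx1] i; rewrite TE; split; first exact: pD.
  exact: le_trans (NM i x Dx) Mx1.
split.
  split=> // [x Dx Mx0|x y Dx Dy|a x Dx].
  - apply: p_inj => i; apply: Nd; first exact: pD.
    by apply/le_anti; rewrite -{1}Mx0 NM// N0//; exact: pD.
  - apply: Mle => [|i]; first by rewrite addr_ge0 ?M0.
    rewrite linearD; apply: le_trans (ND _ _ _ _ _) _; [exact: pD..|].
    by rewrite lerD ?NM.
  - apply/eqP; rewrite eq_le MZle//=.
    have [->|a0] := eqVneq a 0.
      by rewrite ComplexField.Normc.normc0 mul0r M0//; exact: linear_spanZ.
    have na0 : 0 < normc a.
      rewrite lt_neqAle normc_ge0 andbT eq_sym.
      by apply: contra_neq a0; exact: ComplexField.Normc.eq0_normc.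
    rewrite -ler_pdivlMl// -ComplexField.Normc.normcV.
    rewrite -[in leLHS](scale1r x) -(mulVf a0) -scalerA.
    by apply: MZle; exact: linear_spanZ.
move=> u Du cu.
have /(_ _)/cid2 L i : exists2 l, linear_span (T i) l &
    converges_for (N i) (fun n => p i (u n)) l.
  apply: (bN i).2 => [n|e e0]; first exact: pD.
  have [k kP] := cu e e0; exists k => m n km kn.
  rewrite -linearB; apply: le_lt_trans (kP m n km kn).
  by apply: NM; exact: linear_spanB.
have [w wP] := lift (fun i => s2val (L i)) (fun i => s2valP (L i)).
have uw (e : R) : 0 < e ->
    exists k, forall n, (k <= n)%N -> forall i, N i (p i (u n - w)) <= e.
  move=> e0; have e20 : 0 < e / 2 by rewrite divr_gt0.
  have [k kP] := cu _ e20; exists k => n kn i.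
  have [k' kP'] := s2valP' (L i) _ e20.
  pose m := maxn k k'.
  have -> : p i (u n - w) = p i (u n - u m) + (p i (u m) - s2val (L i)).
    by rewrite -wP -linearB -linearD addrA subrK.
  have sL := s2valP (L i).
  apply: le_trans (ND _ _ _ _ _) _.
  - by apply: pD; exact: linear_spanB.
  - by apply: linear_spanB => //; exact: pD.
  rewrite [leRHS]splitr lerD//.
    apply: le_trans (NM _ _ _) _; first exact: linear_spanB.
    by apply: ltW; apply: kP => //; exact: leq_maxl.
  by apply: ltW; apply: kP'; exact: leq_maxr.
have Dw : linear_span D w.
  have [k kP] := uw 1 ltr01.
  rewrite -[w](subKr (u k)); apply: linear_spanB => //.
  apply: linear_span_sub => i; rewrite TE; split; last exact: kP.
  rewrite linearB wP; apply: linear_spanB; [exact: pD|exact: s2valP].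
exists w => // e e0; have e20 : 0 < e / 2 by rewrite divr_gt0.
have [k kP] := uw _ e20; exists k => n kn.
apply: (@le_lt_trans _ _ (e / 2)); last by rewrite ltr_pdivrMr// ltr_pMr// ltr1n.
by apply: Mle => [|i]; [exact: ltW|exact: kP].
Qed.

Lemma complete_bornology_family (B : forall i, set (set (V i)))
    (Q : set (set I)) :
  (forall i, complete_bornology (B i)) ->
  (forall x, exists2 F, Q F & forall i, ~ F i -> p i x = 0) ->
  (forall F G, Q F -> Q G -> Q (F `|` G)) ->
  (forall F (l : forall i, V i), Q F -> (forall i, ~ F i -> l i = 0) ->
     exists w, forall i, p i w = l i) ->
  complete_bornology [set S : set W |
    (exists2 F, Q F & forall x, S x -> forall i, ~ F i -> p i x = 0) /\
    (forall i, B i (p i @` S))].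
Proof.
move=> bB Qx QU lift; split.
- move=> S T ST [[F QF FT] BT]; split.
    by exists F => // x /ST; exact: FT.
  by move=> i; apply: (born_sub (bB i)) (BT i); exact: image_subset.
- move=> x; split; first by have [F QF Fx] := Qx x; exists F => // _ ->.
  by move=> i; rewrite image_set1; exact: born_point (bB i) _.
- move=> S T [[F QF FS] BS] [[G QG GT] BT]; split.
    exists (F `|` G); first exact: QU.
    by move=> x [Sx|Tx] i /not_orP [nF nG]; [exact: FS|exact: GT].
  by move=> i; rewrite image_setU; exact: born_union (bB i) _ _ (BS i) (BT i).
- move=> S T [[F QF FS] BS] [[G QG GT] BT]; split.
    exists (F `|` G); first exact: QU.
    move=> _ [x Sx [y Ty <-]] i /not_orP [nF nG].
    by rewrite linearD FS// GT// addr0.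
  move=> i; apply: (born_sub (bB i)) (born_add (bB i) (BS i) (BT i)).
  move=> _ [_ [x Sx [y Ty <-]] <-]; rewrite linearD.
  by exists (p i x); [exists x|exists (p i y) => //; exists y].
- move=> r S [[F QF FS] BS]; split.
    exists F => // _ [a _ [x Sx <-]] i nF.
    by rewrite linearZ_LR FS// scaler0.
  move=> i; apply: (born_sub (bB i)) (born_scale (bB i) r (BS i)).
  move=> _ [_ [a ar [x Sx <-]] <-]; rewrite linearZ.
  by exists a => //; exists (p i x) => //; exists x.
move=> S [[F QF FS] BS].
have /(_ _)/cid D i := born_disk (bB i) (BS i).
pose T i := if pselect (F i) is left _ then projT1 (D i) else [set 0].
have bT i : banach_disk (T i).
  rewrite /T; case: pselect => _; last exact: banach_disk0.
  by have [] := projT2 (D i).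
exists [set w | forall i, T i (p i w)]; split.
- split.
    exists F => // x Tx i nF; have := Tx i.
    by rewrite /T; case: pselect.
  move=> i; have [BD _ _] := projT2 (D i).
  apply: (born_sub (bB i)) (born_union (bB i) BD (born_point (bB i) 0)).
  move=> _ [x Tx <-]; have := Tx i.
  by rewrite /T; case: pselect => _; [left|right].
- move=> x Sx i; rewrite /T; case: pselect => [_|nF]; last exact: FS.
  by have [_ SD _] := projT2 (D i); apply: SD; exists x.
- apply: banach_disk_family => // l sl; apply: (lift F) => // i nF.
  by have := sl i; rewrite /T; case: pselect => // _ /linear_span_set0.
Qed.

End FamilyBornology.

Record bornSpace := BornSpace {
  born_sort :> lmodType C;
  bdd : set (set born_sort);
  bdd_complete : complete_bornology bdd }.

Definition bounded_map (V W : bornSpace) (f : V -> W) : Prop :=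
  forall S, bdd S -> bdd (f @` S).

Definition bounded_bilinear (U V W : bornSpace) (m : U -> V -> W) : Prop :=
  [/\ forall u, linear (m u),
      forall v, linear (m^~ v)
    & forall S T, bdd S -> bdd T -> bdd [set m u v | u in S & v in T]].

Definition prod_bdd I (V : I -> bornSpace) : set (set (dprod V)) :=
  [set S | forall i, bdd (dprod_proj i @` S)].

Fact prod_bdd_complete I (V : I -> bornSpace) : complete_bornology (@prod_bdd I V).
Proof.
have -> : @prod_bdd I V = [set S : set (dprod V) |
    (exists2 F : set I, setT F & forall x, S x -> forall i, ~ F i ->
       dprod_proj i x = 0) /\ (forall i, bdd (dprod_proj i @` S))].
  apply/seteqP; split=> S; last by case.
  by move=> BS; split=> //; exists setT => // x _ i [].
apply: (@complete_bornology_family I V (dprod V)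
  (fun i => dprod_proj i : {linear _ -> _}) _ (fun i => @bdd (V i)) setT).
- by move=> x x0; apply/functional_extensionality_dep => i; exact: x0.
- by move=> i; exact: bdd_complete.
- by move=> x; exists setT => // i [].
- by [].
- by move=> F l _ _; exists l.
Qed.

Definition prod_space I (V : I -> bornSpace) : bornSpace :=
  BornSpace (@prod_bdd_complete I V).

Definition sum_bdd I (V : I -> bornSpace) : set (set (dsum V)) :=
  [set S | (exists2 F : set I, finite_set F &
              forall x, S x -> forall i, ~ F i -> dsum_proj i x = 0) /\
           (forall i, bdd (dsum_proj i @` S))].

Fact sum_bdd_complete I (V : I -> bornSpace) : complete_bornology (@sum_bdd I V).
Proof.
apply: (@complete_bornology_family I V (dsum V)
  (fun i => dsum_proj i : {linear _ -> _}) _ (fun i => @bdd (V i)) finite_set).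
- by move=> x x0; apply/val_inj/functional_extensionality_dep => i; exact: x0.
- by move=> i; exact: bdd_complete.
- move=> x; exists [set i | dsum_fun x i != 0].
    exact/asboolP/(dsum_finsupp x).
  by move=> i /negP; rewrite negbK => /eqP.
- by move=> F G fF fG; rewrite finite_setU.
- move=> F l fF lF.
  have fl : (l : dprod V) \in @finsupp _ _ V.
    apply/asboolP; apply: sub_finite_set fF => i /= li.
    by apply: contrapT => /lF li0; rewrite li0 eqxx in li.
  by exists (DSum fl).
Qed.

Definition sum_space I (V : I -> bornSpace) : bornSpace :=
  BornSpace (@sum_bdd_complete I V).

Definition pair_bdd (V W : bornSpace) : set (set (V * W)%type) :=
  [set S | bdd (fst @` S) /\ bdd (snd @` S)].

Fact pair_bdd_complete V W : complete_bornology (@pair_bdd V W).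
Proof.
pose U b : bornSpace := if b then V else W.
pose p b : {linear (V * W)%type -> U b} :=
  if b return {linear (V * W)%type -> U b} then fst else snd.
have -> : @pair_bdd V W = [set S : set (V * W)%type |
    (exists2 F : set bool, setT F & forall x, S x -> forall b, ~ F b ->
       p b x = 0) /\ (forall b, bdd (p b @` S))].
  apply/seteqP; split=> S.
    by move=> [BV BW]; split=> [|[]//]; exists setT => // x _ i [].
  by move=> [_ BS]; split; [exact: (BS true)|exact: (BS false)].
apply: (@complete_bornology_family bool U (V * W)%type p _
  (fun b => @bdd (U b)) setT).
- by move=> [x y] xy0; congr pair; [exact: (xy0 true)|exact: (xy0 false)].
- by move=> i; exact: bdd_complete.
- by move=> x; exists setT => // i [].
- by [].
- by move=> F l _ _; exists (l true, l false) => -[].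
Qed.

Definition pair_space (V W : bornSpace) : bornSpace :=
  BornSpace (@pair_bdd_complete V W).

Fact zero_bdd_complete : complete_bornology [set: set 'rV[C]_0].
Proof.
split=> // S _; exists [set 0]; split=> //; last exact: banach_disk0.
by move=> x _; rewrite [x]thinmx0.
Qed.

Definition zero_space : bornSpace := BornSpace zero_bdd_complete.

(* The library's [algType] requires [1 != 0]; the zero algebra is allowed. *)
Record bornAlg := BornAlg {
  alg_space :> bornSpace;
  alg_one : alg_space;
  alg_mul : alg_space -> alg_space -> alg_space;
  alg_mulA : associative alg_mul;
  alg_mul1l : left_id alg_one alg_mul;
  alg_mul1r : right_id alg_one alg_mul;
  alg_mul_bounded : bounded_bilinear alg_mul }.

End Bornology.

Section Modules.
Context (R : realType) (A : bornAlg R).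

Record bornMod := BornMod {
  mod_space :> bornSpace R;
  act : A -> mod_space -> mod_space;
  act_mul : forall a b x, act (alg_mul a b) x = act a (act b x);
  act_one : forall x, act (alg_one A) x = x;
  act_bounded : bounded_bilinear act }.

Record bornHom (M N : bornMod) := BornHom {
  hom_fun :> M -> N;
  hom_linear : linear hom_fun;
  hom_act : forall a x, hom_fun (act a x) = act a (hom_fun x);
  hom_bounded : bounded_map hom_fun }.

HB.instance Definition _ (M N : bornMod) (f : bornHom M N) :=
  GRing.isLinear.Build R[i] M N *:%R (hom_fun f) (@hom_linear M N f).

Lemma act_linear (M : bornMod) a : linear (@act M a).
Proof. by have [+ _ _] := act_bounded M; exact. Qed.

Lemma act_linearl (M : bornMod) (x : M) : linear (fun a => act a x).
Proof. by have [_ + _] := act_bounded M; exact. Qed.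

Lemma act_bdd (M : bornMod) (S : set A) (T : set M) :
  bdd S -> bdd T -> bdd [set act a x | a in S & x in T].
Proof. by have [_ _ +] := act_bounded M; exact. Qed.

Lemma act0 (M : bornMod) a : act a (0 : M) = 0.
Proof.
have := act_linear a (-1) (0 : M) 0.
by rewrite scaler0 addr0 scaleN1r addNr.
Qed.

Section Families.
Context (I : Type) (M : I -> bornMod).

Definition prod_act (a : A) (x : prod_space M) : prod_space M :=
  fun i => act a (x i).

Fact prod_act_mul a b x :
  prod_act (alg_mul a b) x = prod_act a (prod_act b x).
Proof. by apply/functional_extensionality_dep => i; exact: act_mul. Qed.

Fact prod_act_one x : prod_act (alg_one A) x = x.
Proof. by apply/functional_extensionality_dep => i; exact: act_one. Qed.

Fact prod_act_bounded : bounded_bilinear prod_act.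
Proof.
split=> [a c x y|x c a b|S T BS BT i].
- by apply/functional_extensionality_dep => i; exact: act_linear.
- by apply/functional_extensionality_dep => i; exact: act_linearl.
apply: (born_sub (bdd_complete _)) (act_bdd BS (BT i)).
move=> _ [_ [a Sa [x Tx <-]] <-].
by exists a => //; exists (x i) => //; exists x.
Qed.

Definition prod_mod : bornMod :=
  BornMod prod_act_mul prod_act_one prod_act_bounded.

Fact sum_act_finsupp (a : A) (x : sum_space M) :
  prod_act a (dsum_fun x) \in @finsupp _ _ M.
Proof.
apply/asboolP; have /asboolP := dsum_finsupp x.
apply: sub_finite_set => i /=; apply: contra_neq => xi0.
by rewrite /prod_act xi0 act0.
Qed.

Definition sum_act (a : A) (x : sum_space M) : sum_space M :=
  DSum (sum_act_finsupp a x).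

Fact sum_act_mul a b x : sum_act (alg_mul a b) x = sum_act a (sum_act b x).
Proof. by apply/val_inj; exact: prod_act_mul. Qed.

Fact sum_act_one x : sum_act (alg_one A) x = x.
Proof. by apply/val_inj; exact: prod_act_one. Qed.

Fact sum_act_bounded : bounded_bilinear sum_act.
Proof.
split=> [a c x y|x c a b|S T BS [[F fF FT] BT]].
- by apply/val_inj/functional_extensionality_dep => i; exact: act_linear.
- by apply/val_inj/functional_extensionality_dep => i; exact: act_linearl.
split.
  exists F => // _ [a _ [x Tx <-]] i nF.
  by have := FT x Tx i nF; rewrite /dsum_proj /= /prod_act => ->; exact: act0.
move=> i; apply: (born_sub (bdd_complete _)) (act_bdd BS (BT i)).
move=> _ [_ [a Sa [x Tx <-]] <-].
by exists a => //; exists (dsum_proj i x) => //; exists x.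
Qed.

Definition sum_mod : bornMod := BornMod sum_act_mul sum_act_one sum_act_bounded.

End Families.

Section Pair.
Context (M N : bornMod).

Definition pair_act (a : A) (x : pair_space M N) : pair_space M N :=
  (act a x.1, act a x.2).

Fact pair_act_mul a b x :
  pair_act (alg_mul a b) x = pair_act a (pair_act b x).
Proof. by rewrite /pair_act !act_mul. Qed.

Fact pair_act_one x : pair_act (alg_one A) x = x.
Proof. by case: x => x y; rewrite /pair_act !act_one. Qed.

Fact pair_act_bounded : bounded_bilinear pair_act.
Proof.
split=> [a c x y|x c a b|S T BS [BT1 BT2]].
- by rewrite /pair_act !act_linear.
- by rewrite /pair_act !act_linearl.
split.
  apply: (born_sub (bdd_complete _)) (act_bdd BS BT1).
  move=> _ [_ [a Sa [x Tx <-]] <-].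
  by exists a => //; exists x.1 => //; exists x.
apply: (born_sub (bdd_complete _)) (act_bdd BS BT2).
move=> _ [_ [a Sa [x Tx <-]] <-].
by exists a => //; exists x.2 => //; exists x.
Qed.

Definition pair_mod : bornMod :=
  BornMod pair_act_mul pair_act_one pair_act_bounded.

Lemma pair_mod_eq (x y : pair_mod) : x.1 = y.1 -> x.2 = y.2 -> x = y.
Proof. by case: x y => [? ?] [? ?] /= -> ->. Qed.

End Pair.

Definition zero_act (a : A) (x : zero_space R) : zero_space R := x.

Fact zero_act_bounded : bounded_bilinear zero_act.
Proof.
split=> // x c a b.
by rewrite [LHS](thinmx0 (x : 'rV_0)) [RHS](thinmx0 (_ : 'rV_0)).
Qed.

Definition zero_mod : bornMod :=
  @BornMod (zero_space R) zero_act (fun _ _ _ => erefl) (fun=> erefl)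
    zero_act_bounded.

Section Homs.
Context (M N P : bornMod).

Fact hom_id_linear : linear (@id M). Proof. by []. Qed.
Fact hom_id_bounded : bounded_map (@id M).
Proof. by move=> S; rewrite image_id. Qed.
Definition hom_id : bornHom M M :=
  BornHom hom_id_linear (fun _ _ => erefl) hom_id_bounded.

Fact hom_comp_linear (g : bornHom N P) (f : bornHom M N) : linear (g \o f).
Proof. by move=> a x y /=; rewrite !linearP. Qed.
Fact hom_comp_act (g : bornHom N P) (f : bornHom M N) a x :
  (g \o f) (act a x) = act a ((g \o f) x).
Proof. by rewrite /= !hom_act. Qed.
Fact hom_comp_bounded (g : bornHom N P) (f : bornHom M N) :
  bounded_map (g \o f).
Proof. by move=> S BS; rewrite -image_comp; do 2!apply: hom_bounded. Qed.
Definition hom_comp (g : bornHom N P) (f : bornHom M N) : bornHom M P :=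
  BornHom (hom_comp_linear g f) (hom_comp_act g f) (@hom_comp_bounded g f).

Definition hom_zero_fun (x : M) : N := 0.
Fact hom_zero_linear : linear hom_zero_fun.
Proof. by move=> a x y; rewrite /hom_zero_fun scaler0 addr0. Qed.
Fact hom_zero_act a x : hom_zero_fun (act a x) = act a (hom_zero_fun x).
Proof. by rewrite act0. Qed.
Fact hom_zero_bounded : bounded_map hom_zero_fun.
Proof.
move=> S _; apply: (born_sub (bdd_complete N)) (born_point (bdd_complete N) 0).
by move=> _ [x _ <-].
Qed.
Definition hom_zero : bornHom M N :=
  BornHom hom_zero_linear hom_zero_act hom_zero_bounded.

Definition hom_opp_fun (f : bornHom M N) (x : M) : N := - f x.
Fact hom_opp_linear f : linear (hom_opp_fun f).
Proof. by move=> a x y; rewrite /hom_opp_fun linearP opprD scalerN. Qed.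
Fact hom_opp_act f a x : hom_opp_fun f (act a x) = act a (hom_opp_fun f x).
Proof.
have := act_linear a (-1) (f x) 0.
by rewrite act0 !addr0 !scaleN1r /hom_opp_fun hom_act => ->.
Qed.
Fact hom_opp_bounded f : bounded_map (hom_opp_fun f).
Proof.
move=> S BS; apply: (born_sub (bdd_complete N))
  (born_scale (bdd_complete N) 1 (@hom_bounded _ _ f S BS)).
move=> _ [x Sx <-]; exists (-1).
  by rewrite /mkset normcN ComplexField.Normc.normc1.
by exists (f x); [exists x|rewrite scaleN1r].
Qed.
Definition hom_opp f : bornHom M N :=
  BornHom (hom_opp_linear f) (hom_opp_act f) (@hom_opp_bounded f).

Definition hom_add_fun (f g : bornHom M N) (x : M) : N := f x + g x.
Fact hom_add_linear f g : linear (hom_add_fun f g).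
Proof.
by move=> a x y; rewrite /hom_add_fun !linearP scalerDr addrACA.
Qed.
Fact hom_add_act f g a x : hom_add_fun f g (act a x) = act a (hom_add_fun f g x).
Proof.
have := act_linear a 1 (f x) (g x).
by rewrite !scale1r /hom_add_fun !hom_act => ->.
Qed.
Fact hom_add_bounded f g : bounded_map (hom_add_fun f g).
Proof.
move=> S BS; apply: (born_sub (bdd_complete N)) (born_add (bdd_complete N)
  (@hom_bounded _ _ f S BS) (@hom_bounded _ _ g S BS)).
move=> _ [x Sx <-]; exists (f x); first by exists x.
by exists (g x) => //; exists x.
Qed.
Definition hom_add f g : bornHom M N :=
  BornHom (hom_add_linear f g) (hom_add_act f g) (@hom_add_bounded f g).

Fact hom_fst_linear : linear (fst : pair_mod M N -> M). Proof. by []. Qed.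
Fact hom_fst_bounded : @bounded_map _ (pair_mod M N) M fst.
Proof. by move=> S []. Qed.
Definition hom_fst : bornHom (pair_mod M N) M :=
  BornHom hom_fst_linear (fun _ _ => erefl) hom_fst_bounded.

Fact hom_snd_linear : linear (snd : pair_mod M N -> N). Proof. by []. Qed.
Fact hom_snd_bounded : @bounded_map _ (pair_mod M N) N snd.
Proof. by move=> S []. Qed.
Definition hom_snd : bornHom (pair_mod M N) N :=
  BornHom hom_snd_linear (fun _ _ => erefl) hom_snd_bounded.

Definition hom_pair_fun (f : bornHom P M) (g : bornHom P N) (x : P) :
  pair_mod M N := (f x, g x).
Fact hom_pair_linear f g : linear (hom_pair_fun f g).
Proof. by move=> a x y; rewrite /hom_pair_fun !linearP. Qed.
Fact hom_pair_act f g a x :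
  hom_pair_fun f g (act a x) = act a (hom_pair_fun f g x).
Proof. by rewrite /hom_pair_fun !hom_act. Qed.
Fact hom_pair_bounded f g : bounded_map (hom_pair_fun f g).
Proof.
by move=> S BS; split; rewrite image_comp;
  [exact: (@hom_bounded _ _ f)|exact: (@hom_bounded _ _ g)].
Qed.
Definition hom_pair f g : bornHom P (pair_mod M N) :=
  BornHom (hom_pair_linear f g) (hom_pair_act f g) (@hom_pair_bounded f g).

End Homs.

Section FamilyHoms.
Context (I : Type) (M N : I -> bornMod) (f : forall i, bornHom (M i) (N i)).

Definition hom_prod_fun (x : prod_mod M) : prod_mod N := fun i => f i (x i).
Fact hom_prod_linear : linear hom_prod_fun.
Proof.
by move=> a x y; apply/functional_extensionality_dep => i; exact: hom_linear.
Qed.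
Fact hom_prod_act a x : hom_prod_fun (act a x) = act a (hom_prod_fun x).
Proof. by apply/functional_extensionality_dep => i; exact: hom_act. Qed.
Fact hom_prod_bounded : bounded_map hom_prod_fun.
Proof.
move=> S BS i; rewrite image_comp.
rewrite (_ : _ @` S = f i @` (dprod_proj i @` S)); last by rewrite image_comp.
exact: hom_bounded (BS i).
Qed.
Definition hom_prod : bornHom (prod_mod M) (prod_mod N) :=
  BornHom hom_prod_linear hom_prod_act hom_prod_bounded.

Fact hom_sum_finsupp (x : sum_mod M) :
  hom_prod_fun (dsum_fun x) \in @finsupp _ _ N.
Proof.
apply/asboolP; have /asboolP := dsum_finsupp x.
apply: sub_finite_set => i /=; apply: contra_neq => xi0.
by rewrite /hom_prod_fun xi0 linear0.
Qed.
Definition hom_sum_fun (x : sum_mod M) : sum_mod N := DSum (hom_sum_finsupp x).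
Fact hom_sum_linear : linear hom_sum_fun.
Proof. by move=> a x y; apply/val_inj; exact: hom_prod_linear. Qed.
Fact hom_sum_act a x : hom_sum_fun (act a x) = act a (hom_sum_fun x).
Proof. by apply/val_inj; exact: hom_prod_act. Qed.
Fact hom_sum_bounded : bounded_map hom_sum_fun.
Proof.
move=> S [[F fF FS] BS]; split.
  exists F => // _ [x Sx <-] i nF.
  have := FS x Sx i nF; rewrite /dsum_proj /= /hom_prod_fun => ->.
  exact: linear0.
move=> i; rewrite image_comp.
rewrite (_ : _ @` S = f i @` (dsum_proj i @` S)); last by rewrite image_comp.
exact: hom_bounded (BS i).
Qed.
Definition hom_sum : bornHom (sum_mod M) (sum_mod N) :=
  BornHom hom_sum_linear hom_sum_act hom_sum_bounded.

End FamilyHoms.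

Record chainComplex := ChainComplex {
  cx_obj :> int -> bornMod;
  cx_d : forall n : int, bornHom (cx_obj n) (cx_obj (n - 1));
  cx_dd : forall (n : int) (x : cx_obj n), cx_d (n - 1) (cx_d n x) = 0 }.
Arguments cx_d X n : rename.

Record chainMap (X Y : chainComplex) := ChainMap {
  cm_fun :> forall n : int, bornHom (X n) (Y n);
  cm_comm : forall (n : int) (x : X n),
    cx_d Y n (cm_fun n x) = cm_fun (n - 1) (cx_d X n x) }.

Definition cm_id X : chainMap X X :=
  @ChainMap X X (fun n => hom_id (X n)) (fun _ _ => erefl).

Fact cm_comp_comm X Y Z (g : chainMap Y Z) (f : chainMap X Y) (n : int) (x : X n) :
  cx_d Z n (g n (f n x)) = g (n - 1) (f (n - 1) (cx_d X n x)).
Proof. by rewrite !cm_comm. Qed.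

Definition cm_comp X Y Z (g : chainMap Y Z) (f : chainMap X Y) : chainMap X Z :=
  @ChainMap X Z (fun n => hom_comp (g n) (f n)) (@cm_comp_comm X Y Z g f).

(* The homotopy identity is stated in degree [n - 1], for all [n], so that both
   sides have the same type without transport along [n - 1 + 1 = n]. *)
Definition homotopic X Y (f g : chainMap X Y) : Prop :=
  exists h : forall n : int, bornHom (X (n - 1)) (Y n),
    forall (n : int) (x : X (n - 1)),
      f (n - 1) x - g (n - 1) x =
      cx_d Y n (h n x) + h (n - 1) (cx_d X (n - 1) x).

(* [f] represents an isomorphism of the homotopy category. *)
Definition ho_iso X Y (f : chainMap X Y) : Prop :=
  exists g : chainMap Y X,
    homotopic (cm_comp g f) (cm_id X) /\ homotopic (cm_comp f g) (cm_id Y).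

Definition ho_isomorphic X Y : Prop := exists f : chainMap X Y, ho_iso f.

Fact shift_dd (X : chainComplex) (n : int) (x : X (n - 1)) :
  hom_opp (cx_d X (n - 1 - 1)) (hom_opp (cx_d X (n - 1)) x) = 0.
Proof. by rewrite /= /hom_opp_fun linearN opprK; exact: cx_dd. Qed.

Definition shift (X : chainComplex) : chainComplex :=
  @ChainComplex (fun n => X (n - 1)) (fun n => hom_opp (cx_d X (n - 1)))
    (@shift_dd X).

Fact shift_map_comm X Y (f : chainMap X Y) (n : int) (x : shift X n) :
  cx_d (shift Y) n (f (n - 1) x) = f (n - 1 - 1) (cx_d (shift X) n x).
Proof. by rewrite /= /hom_opp_fun cm_comm linearN. Qed.

Definition shift_map X Y (f : chainMap X Y) : chainMap (shift X) (shift Y) :=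
  @ChainMap (shift X) (shift Y) (fun n => f (n - 1)) (@shift_map_comm X Y f).

Definition hom_cast (X : int -> bornMod) (m n : int) (e : m = n) : bornHom (X m) (X n) :=
  match e in _ = k return bornHom (X m) (X k) with erefl => hom_id (X m) end.

Fact pred_succC (n : int) : n + 1 - 1 = n - 1 + 1.
Proof. by rewrite addrK subrK. Qed.

Lemma cx_d_cast (X : chainComplex) (m n : int) (e : m = n) (x : X m) :
  cx_d X n (hom_cast X e x) = hom_cast X (congr1 (fun k => k - 1) e) (cx_d X m x).
Proof. by case: _ / e. Qed.

Definition unshift_d (X : chainComplex) (n : int) :
    bornHom (X (n + 1)) (X (n - 1 + 1)) :=
  hom_opp (hom_comp (hom_cast X (pred_succC n)) (cx_d X (n + 1))).

Fact unshift_dd (X : chainComplex) (n : int) (x : X (n + 1)) :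
  unshift_d X (n - 1) (unshift_d X n x) = 0.
Proof.
by rewrite /= /hom_opp_fun /= !linearN /= opprK cx_d_cast cx_dd !linear0.
Qed.

Definition unshift (X : chainComplex) : chainComplex :=
  @ChainComplex (fun n => X (n + 1)) (unshift_d X) (@unshift_dd X).

Section Cone.
Context (X Y : chainComplex) (f : chainMap X Y).

(* [d (x, y) = (- d x, f x + d y)] *)
Definition cone_d (n : int) :
    bornHom (pair_mod (X (n - 1)) (Y n)) (pair_mod (X (n - 1 - 1)) (Y (n - 1))) :=
  hom_pair
    (hom_opp (hom_comp (cx_d X (n - 1)) (hom_fst _ _)))
    (hom_add (hom_comp (f (n - 1)) (hom_fst _ _))
             (hom_comp (cx_d Y n) (hom_snd _ _))).

Fact cone_dd (n : int) x : cone_d (n - 1) (cone_d n x) = 0.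
Proof.
case: x => x y; apply: pair_mod_eq.
  change (- cx_d X (n - 1 - 1) (- cx_d X (n - 1) x) = 0).
  by rewrite linearN /= cx_dd !oppr0.
change (f (n - 1 - 1) (- cx_d X (n - 1) x) +
        cx_d Y (n - 1) (f (n - 1) x + cx_d Y n y) = 0).
by rewrite linearN linearD /= cx_dd cm_comm addr0 addNr.
Qed.

Definition cone : chainComplex :=
  @ChainComplex (fun n => pair_mod (X (n - 1)) (Y n)) cone_d cone_dd.

Fact cone_in_comm (n : int) (y : Y n) :
  cx_d cone n (hom_pair (hom_zero (Y n) (X (n - 1))) (hom_id (Y n)) y) =
  hom_pair (hom_zero (Y (n - 1)) (X (n - 1 - 1))) (hom_id (Y (n - 1)))
    (cx_d Y n y).
Proof.
apply: pair_mod_eq.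
  change (- cx_d X (n - 1) 0 = 0); by rewrite linear0 oppr0.
change (f (n - 1) 0 + cx_d Y n y = cx_d Y n y); by rewrite linear0 add0r.
Qed.

Definition cone_in : chainMap Y cone :=
  @ChainMap Y cone
    (fun n => hom_pair (hom_zero (Y n) (X (n - 1))) (hom_id (Y n))) cone_in_comm.

Definition cone_out : chainMap cone (shift X) :=
  @ChainMap cone (shift X) (fun n => hom_fst (X (n - 1)) (Y n))
    (fun _ _ => erefl).

End Cone.

Definition exact_triangle X Y Z (f : chainMap X Y) (g : chainMap Y Z)
    (h : chainMap Z (shift X)) : Prop :=
  exists (X' Y' : chainComplex) (u : chainMap X' Y')
    (a : chainMap X X') (b : chainMap Y Y') (c : chainMap Z (cone u)),
    [/\ ho_iso a, ho_iso b & ho_iso c] /\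
    [/\ homotopic (cm_comp b f) (cm_comp u a),
        homotopic (cm_comp c g) (cm_comp (cone_in u) b)
      & homotopic (cm_comp (shift_map a) h) (cm_comp (cone_out u) c)].

Definition degree0_obj (M : bornMod) (n : int) : bornMod :=
  if n == 0 then M else zero_mod.

Definition degree0 (M : bornMod) : chainComplex :=
  @ChainComplex (degree0_obj M)
    (fun n => hom_zero (degree0_obj M n) (degree0_obj M (n - 1)))
    (fun _ _ => erefl).

Fact prod_dd I (X : I -> chainComplex) (n : int) (x : prod_mod (fun i => X i n)) :
  hom_prod (fun i => cx_d (X i) (n - 1)) (hom_prod (fun i => cx_d (X i) n) x) = 0.
Proof. by apply/functional_extensionality_dep => i; exact: cx_dd. Qed.

Definition prod_complex I (X : I -> chainComplex) : chainComplex :=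
  @ChainComplex (fun n => prod_mod (fun i => X i n))
    (fun n => hom_prod (fun i => cx_d (X i) n)) (@prod_dd I X).

Fact sum_dd I (X : I -> chainComplex) (n : int) (x : sum_mod (fun i => X i n)) :
  hom_sum (fun i => cx_d (X i) (n - 1)) (hom_sum (fun i => cx_d (X i) n) x) = 0.
Proof. by apply/val_inj/functional_extensionality_dep => i; exact: cx_dd. Qed.

Definition sum_complex I (X : I -> chainComplex) : chainComplex :=
  @ChainComplex (fun n => sum_mod (fun i => X i n))
    (fun n => hom_sum (fun i => cx_d (X i) n)) (@sum_dd I X).

(* A full subcategory is given by its class of objects. *)
Record triangulated_subcategory (T : chainComplex -> Prop) : Prop := {
  tri_iso : forall X Y, ho_isomorphic X Y -> T X -> T Y;
  tri_shift : forall X, T X -> T (shift X);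
  tri_unshift : forall X, T X -> T (unshift X);
  tri_third : forall X Y Z (f : chainMap X Y) (g : chainMap Y Z)
      (h : chainMap Z (shift X)), exact_triangle f g h ->
    [/\ T X -> T Y -> T Z, T Y -> T Z -> T X & T X -> T Z -> T Y] }.

Definition closed_under_direct_sums (T : chainComplex -> Prop) : Prop :=
  forall (I : Type) (X : I -> chainComplex),
    (forall i, T (X i)) -> T (sum_complex X).

Definition closed_under_direct_products (T : chainComplex -> Prop) : Prop :=
  forall (I : Type) (X : I -> chainComplex),
    (forall i, T (X i)) -> T (prod_complex X).

End Modules.

(* Main.v *)
Require Import Defs.
From HB Require Import structures.
From mathcomp Require Import all_boot all_order all_algebra.
From mathcomp Require Import complex.
From mathcomp Require Import all_classical all_reals.

(** Let [Z] be the graded module of cycles of [X] and let [X'] be [X] with its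
    differential replaced by zero; regard [Z] as a complex with zero
    differential. The automorphism [(z, x) |-> (z + d x, x)] identifies the cone
    of the inclusion [Z -> X] with the cone of the inclusion [Z -> X'].
    A complex with zero differential is at once the direct sum and the direct
    product of its shifted components, so [Z] and [X'] belong to the
    subcategory; hence so do the common cone and, finally, [X]. *)

Set Implicit Arguments.
Unset Strict Implicit.
Unset Printing Implicit Defensive.

Import Order.TTheory GRing.Theory Num.Theory.
Local Open Scope classical_set_scope.
Local Open Scope ring_scope.

(** * Rescaling in the normed span of a Banach disk *)

Section BanachDisks.
Context (R : realType).
Local Notation C := (R[i]).
Local Notation normc := (@ComplexField.Normc.normc R).

Lemma normc_real (r : R) : 0 <= r -> normc (r%:C)%C = r.
Proof.
move=> r0.
by rewrite /ComplexField.Normc.normc /= expr0n /= addr0 sqrtr_sqr ger0_norm.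
Qed.

Lemma real_complexVK (V : lmodType C) (c : R) (x : V) :
  0 < c -> (c%:C)%C *: ((c^-1%:C)%C *: x) = x.
Proof.
by move=> c0; rewrite scalerA -rmorphM /= divff ?gt_eqF// rmorph1 scale1r.
Qed.

Section DiskNorm.
Context (V : lmodType C) (T : set V) (N : V -> R).
Hypothesis bN : banach_on (linear_span T) N.
Hypothesis TE : T = [set x | linear_span T x /\ N x <= 1].

Lemma disk_rescale (c : R) x :
  0 < c -> linear_span T x -> N x <= c -> T ((c^-1%:C)%C *: x).
Proof.
move=> c0 sx Nx; rewrite TE; split; first exact: linear_spanZ.
have [[_ _ _ NZ] _] := bN.
rewrite NZ// normc_real; last by rewrite invr_ge0 ltW.
by rewrite ler_pdivrMl// mulr1.
Qed.

Lemma disk_norm_le (c : R) x : 0 < c -> T x -> N ((c%:C)%C *: x) <= c.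
Proof.
move=> c0; rewrite {1}TE => -[sx Nx]; have [[_ _ _ NZ] _] := bN.
have c0' := ltW c0.
by rewrite NZ// normc_real// -[leRHS]mulr1 ler_wpM2l.
Qed.

End DiskNorm.

(** Dividing by [c] moves [x] into [S], [f] moves it into [T], and multiplying back gives the bound:
    [f] is contractive for the two norms. An arbitrary [c > 0] replaces [N x] itself, which could be
    zero and could not be divided by. *)
Lemma disk_norm_image (V W : lmodType C) (f : {linear V -> W})
    (S : set V) (N : V -> R) (T : set W) (N' : W -> R) :
  banach_on (linear_span S) N -> S = [set x | linear_span S x /\ N x <= 1] ->
  banach_on (linear_span T) N' -> T = [set x | linear_span T x /\ N' x <= 1] ->
  f @` S `<=` T ->
  forall c x, 0 < c -> linear_span S x -> N x <= c -> N' (f x) <= c.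
Proof.
move=> bN SE bN' TE fST c x c0 sx Nx.
rewrite -(real_complexVK x c0) linearZ_LR.
apply: (disk_norm_le bN' TE c0).
by apply: fST; eexists; [exact: (disk_rescale bN SE c0 sx Nx)|].
Qed.

End BanachDisks.

(** * Kernels in the category of bornological modules *)

Section Kernel.
Context (R : realType) (A : bornAlg R) (M N : bornMod A) (f : bornHom M N).
Local Notation C := (R[i]).

Definition in_ker : {pred M} := fun x => f x == 0.

Fact in_ker_submod : submod_closed in_ker.
Proof.
split=> [|a x y]; rewrite /in_mem /= /in_ker; first by rewrite linear0.
by move=> /eqP fx /eqP fy; rewrite linearP /= fx fy scaler0 addr0.
Qed.

HB.instance Definition _ :=
  GRing.isSubmodClosed.Build C M in_ker in_ker_submod.

Record ker := Ker { ker_val :> M; ker_valP : ker_val \in in_ker }.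

HB.instance Definition _ := [isSub for ker_val].
HB.instance Definition _ := [Choice of ker by <:].
HB.instance Definition _ := [SubChoice_isSubLmodule of ker by <:].

Fact ker_val_linear : linear ker_val. Proof. by []. Qed.
HB.instance Definition _ :=
  GRing.isLinear.Build C ker M *:%R ker_val ker_val_linear.

Lemma ker_eq0 (x : ker) : f (ker_val x) = 0.
Proof. exact/eqP/(ker_valP x). Qed.

Definition ker_bdd : set (set ker) := [set S | bdd (ker_val @` S)].

(** An element of the kernel lying in the span of [T] is a multiple of an element of [T], and that
    element stays in the kernel. So the norm of [T] restricts to the span of the trace of [T]. *)
Lemma linear_span_ker (T : set M) (n : M -> R) :
  banach_on (linear_span T) n -> T = [set x | linear_span T x /\ n x <= 1] ->
  linear_span [set x : ker | T (ker_val x)] =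
  [set x : ker | linear_span T (ker_val x)].
Proof.
move=> bn TE; apply/seteqP; split=> x.
  by apply: (@linear_span_image _ _ _ ker_val).
move=> /= sx; have [[n0 _ _ _] _] := bn.
(* The summand 1 keeps the rescaling factor invertible when the norm is zero. *)
have c0 : 0 < n (ker_val x) + 1 by apply: ltr_wpDl => //; exact: n0.
rewrite -(real_complexVK x c0); apply/linear_spanZ/linear_span_sub.
rewrite /mkset linearZ_LR; apply: (disk_rescale bn TE c0 sx).
by rewrite lerDl.
Qed.

(* A bounded map is continuous for the norms of suitable Banach disks, so its
   kernel is closed in them. *)
Lemma banach_disk_ker (T : set M) :
  bdd T -> banach_disk T -> banach_disk [set x : ker | T (ker_val x)].
Proof.
move=> BT [cT [n [bn TE]]]; split.
  by move=> a b x y ab Tx Ty; exact: cT.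
exists (n \o ker_val); rewrite (linear_span_ker bn TE).
have [[n0 nd nD nZ] nc] := bn; split; last first.
  by rewrite {1}TE.
split.
  split=> /= [x|x sx nx|x y|a x]; first exact: n0.
  - by apply/val_inj; exact: nd.
  - exact: nD.
  - exact: nZ.
move=> u su cu.
have [|l sl ul] := nc (fun k => ker_val (u k)) su.
  exact: cu.
(* Boundedness of [f] gives a Banach disk [T'] of [N] containing the image of [T], so [f] is
   contractive from [n] to [n']. *)
have [T' [BT' fT' [_ [n' [bn' TE']]]]] :=
  born_disk (bdd_complete N) (hom_bounded f BT).
have [[n'0 n'd _ n'Z] _] := bn'.
have sfl : linear_span T' (f l).
  by apply: (linear_span_image _ sl) => y Ty; apply: fT'; exists y.
(* Since [f] kills every [u k], [f l] is the image of [l - u k], whose norm is arbitrarily small;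
   definiteness of [n'] concludes. *)
have fl0 : f l = 0.
  apply: n'd => //; apply/le_anti; rewrite n'0// andbT.
  apply/ler_addgt0Pr => e e0; rewrite add0r.
  have [k kP] := ul e e0.
  have -> : f l = f (- (ker_val (u k) - l)).
    by rewrite opprB linearB /= ker_eq0 subr0.
  apply: (disk_norm_image bn TE bn' TE' fT' e0).
    by rewrite opprB; apply: linear_spanB => //; exact: su.
  rewrite -scaleN1r nZ; last by apply: linear_spanB => //; exact: su.
  by rewrite normcN ComplexField.Normc.normc1 mul1r ltW// kP.
have kl : l \in in_ker by rewrite /in_mem /= /in_ker fl0.
exists (Ker kl) => // e /ul.
Qed.

Fact ker_bdd_complete : complete_bornology ker_bdd.
Proof.
have bM := bdd_complete M; split.
- by move=> S T ST; apply: (born_sub bM); exact: image_subset.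
- by move=> x; rewrite /ker_bdd /= image_set1; exact: born_point.
- by move=> S T BS BT; rewrite /ker_bdd /= image_setU; exact: born_union.
- move=> S T BS BT; apply: (born_sub bM) (born_add bM BS BT).
  move=> _ [_ [x Sx [y Ty <-]] <-]; exists (ker_val x); first by exists x.
  by exists (ker_val y); [exists y|rewrite linearD].
- move=> r S BS; apply: (born_sub bM) (born_scale bM r BS).
  move=> _ [_ [a ar [x Sx <-]] <-]; exists a => //.
  by exists (ker_val x); [exists x|rewrite linearZ].
move=> S /(born_disk bM) [T [BT ST dT]].
exists [set x : ker | T (ker_val x)]; split.
- by apply: (born_sub bM) BT => _ [x Tx <-].
- by move=> x Sx; apply: ST; exists x.
- exact: banach_disk_ker.
Qed.

Definition ker_space : bornSpace R := BornSpace ker_bdd_complete.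

Fact ker_act_in (a : A) (x : ker_space) : act a (ker_val x) \in in_ker.
Proof. by rewrite /in_mem /= /in_ker hom_act ker_eq0 act0. Qed.

Definition ker_act (a : A) (x : ker_space) : ker_space := Ker (ker_act_in a x).

Fact ker_act_mul a b x : ker_act (alg_mul a b) x = ker_act a (ker_act b x).
Proof. by apply/val_inj; exact: act_mul. Qed.

Fact ker_act_one x : ker_act (alg_one A) x = x.
Proof. by apply/val_inj; exact: act_one. Qed.

Fact ker_act_bounded : bounded_bilinear ker_act.
Proof.
split=> [a c x y|x c a b|S T BS BT].
- by apply/val_inj; exact: act_linear.
- by apply/val_inj; exact: act_linearl.
apply: (born_sub (bdd_complete M)) (act_bdd BS BT).
move=> _ [_ [a Sa [x Tx <-]] <-].
by exists a => //; exists (ker_val x) => //; exists x.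
Qed.

Definition ker_mod : bornMod A :=
  BornMod ker_act_mul ker_act_one ker_act_bounded.

Fact ker_incl_bounded : @bounded_map _ ker_mod M ker_val.
Proof. by []. Qed.

Definition ker_incl : bornHom ker_mod M :=
  @BornHom _ _ ker_mod M ker_val ker_val_linear (fun _ _ => erefl)
    ker_incl_bounded.

Section Lift.
Context (P : bornMod A) (g : bornHom P M) (fg0 : forall x, f (g x) = 0).

Fact ker_lift_in x : g x \in in_ker.
Proof. by rewrite /in_mem /= /in_ker fg0. Qed.

Definition ker_lift_fun (x : P) : ker_mod := Ker (ker_lift_in x).

Fact ker_lift_linear : linear ker_lift_fun.
Proof. by move=> a x y; apply/val_inj; exact: hom_linear. Qed.

Fact ker_lift_act a x : ker_lift_fun (act a x) = act a (ker_lift_fun x).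
Proof. by apply/val_inj; exact: hom_act. Qed.

Fact ker_lift_bounded : bounded_map ker_lift_fun.
Proof.
by move=> S BS; rewrite /bdd /= /ker_bdd /= image_comp; exact: (hom_bounded g).
Qed.

Definition ker_lift : bornHom P ker_mod :=
  BornHom ker_lift_linear ker_lift_act ker_lift_bounded.

End Lift.

End Kernel.

(** * Universal maps of products and direct sums *)

Section FamilyLift.
Context (R : realType) (A : bornAlg R).
Context (I : Type) (P : bornMod A) (M : I -> bornMod A).
Context (f : forall i, bornHom P (M i)).

Definition prod_lift_fun (x : P) : prod_mod M := fun i => f i x.

Fact prod_lift_linear : linear prod_lift_fun.
Proof.
by move=> a x y; apply/functional_extensionality_dep => i; exact: hom_linear.
Qed.

Fact prod_lift_act a x : prod_lift_fun (act a x) = act a (prod_lift_fun x).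
Proof. by apply/functional_extensionality_dep => i; exact: hom_act. Qed.

Fact prod_lift_bounded : bounded_map prod_lift_fun.
Proof. by move=> S BS i; rewrite image_comp; exact: (hom_bounded (f i)). Qed.

Definition prod_lift : bornHom P (prod_mod M) :=
  BornHom prod_lift_linear prod_lift_act prod_lift_bounded.

Section Sum.
Context (F : set I) (finF : finite_set F).
Hypothesis fF : forall i, ~ F i -> forall x, f i x = 0.

Fact sum_lift_finsupp x : prod_lift_fun x \in @finsupp _ _ M.
Proof.
apply/asboolP; apply: sub_finite_set finF => i /=.
by apply: contra_neqP => nF; exact: fF.
Qed.

Definition sum_lift_fun (x : P) : sum_mod M := DSum (sum_lift_finsupp x).

Fact sum_lift_linear : linear sum_lift_fun.
Proof. by move=> a x y; apply/val_inj; exact: prod_lift_linear. Qed.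

Fact sum_lift_act a x : sum_lift_fun (act a x) = act a (sum_lift_fun x).
Proof. by apply/val_inj; exact: prod_lift_act. Qed.

(** Bounded subsets of a direct sum have a common finite support; this is why one [F] must serve for
    all [x]. *)
Fact sum_lift_bounded : bounded_map sum_lift_fun.
Proof.
move=> S BS; split; last first.
  by move=> i; rewrite image_comp; exact: (hom_bounded (f i)).
by exists F => // _ [x _ <-] i nF; exact: fF.
Qed.

Definition sum_lift : bornHom P (sum_mod M) :=
  BornHom sum_lift_linear sum_lift_act sum_lift_bounded.

End Sum.

Fact prod_pr_bounded i : @bounded_map _ (prod_mod M) (M i) (dprod_proj i).
Proof. by move=> S; apply. Qed.

Definition prod_pr i : bornHom (prod_mod M) (M i) :=
  @BornHom _ _ (prod_mod M) (M i) (dprod_proj i) (@dprod_proj_linear _ _ M i)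
    (fun _ _ => erefl) (@prod_pr_bounded i).

Fact sum_pr_bounded i : @bounded_map _ (sum_mod M) (M i) (dsum_proj i).
Proof. by move=> S [_]; apply. Qed.

Definition sum_pr i : bornHom (sum_mod M) (M i) :=
  @BornHom _ _ (sum_mod M) (M i) (dsum_proj i) (@dsum_proj_linear _ _ M i)
    (fun _ _ => erefl) (@sum_pr_bounded i).

End FamilyLift.

(** * Isomorphisms of complexes and cone triangles *)

Section Complexes.
Context (R : realType) (A : bornAlg R).
Implicit Types (X Y Z : chainComplex A) (M : int -> bornMod A).

(** The zero homotopy suffices. Every isomorphism constructed below already holds at the level of
    complexes, so no other homotopy occurs. *)
Lemma homotopic_ext X Y (f g : chainMap X Y) :
  (forall n x, f n x = g n x) -> homotopic f g.
Proof.
move=> fg; exists (fun n => hom_zero (X (n - 1)) (Y n)) => n x.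
by rewrite fg subrr linear0 addr0.
Qed.

Lemma ho_isomorphic_can X Y (f : chainMap X Y) (g : chainMap Y X) :
  (forall n, cancel (f n) (g n)) -> (forall n, cancel (g n) (f n)) ->
  ho_isomorphic X Y.
Proof.
by move=> fK gK; exists f, g; split; apply: homotopic_ext => n x;
  [exact: fK|exact: gK].
Qed.

Lemma ho_iso_id X : ho_iso (cm_id X).
Proof. by exists (cm_id X); split; apply: homotopic_ext. Qed.

Lemma cone_exact_triangle X Y (f : chainMap X Y) :
  exact_triangle f (cone_in f) (cone_out f).
Proof.
exists X, Y, f, (cm_id X), (cm_id Y), (cm_id (cone f)).
by do !split; try exact: ho_iso_id; apply: homotopic_ext.
Qed.

(** Kept transparent so that its components reduce to [f] when inverses are checked. *)
Definition zero_diff_map X Y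
    (X0 : forall n x, cx_d X n x = 0) (Y0 : forall n y, cx_d Y n y = 0)
    (f : forall n, bornHom (X n) (Y n)) : chainMap X Y.
Proof.
by exists f => n x; rewrite X0 Y0 linear0.
Defined.

Lemma zero_diff_iso X Y :
  (forall n x, cx_d X n x = 0) -> (forall n y, cx_d Y n y = 0) ->
  forall (f : forall n, bornHom (X n) (Y n)) (g : forall n, bornHom (Y n) (X n)),
  (forall n, cancel (f n) (g n)) -> (forall n, cancel (g n) (f n)) ->
  ho_isomorphic X Y.
Proof.
move=> X0 Y0 f g fK gK.
exact: (@ho_isomorphic_can _ _ (zero_diff_map X0 Y0 f) (zero_diff_map Y0 X0 g)).
Qed.

(** Unlike [hom_cast], this transports along an equality of modules. It serves to compare shifts of
    a module placed in one degree, where the two sides differ only in the test selecting that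
    degree. *)
Definition hom_eq (M N : bornMod A) (e : M = N) : bornHom M N :=
  match e in _ = K return bornHom M K with erefl => hom_id M end.

Lemma zero_diff_eq_iso X Y :
  (forall n x, cx_d X n x = 0) -> (forall n y, cx_d Y n y = 0) ->
  (forall n, X n = Y n) -> ho_isomorphic X Y.
Proof.
move=> X0 Y0 XY.
apply: (zero_diff_iso X0 Y0 (f := fun n => hom_eq (XY n))
  (g := fun n => hom_eq (esym (XY n)))) => n; by case: _ / (XY n).
Qed.

(** * Complexes with zero differential as sums and products *)

Definition graded_complex M : chainComplex A :=
  @ChainComplex _ _ M (fun n => hom_zero (M n) (M (n - 1))) (fun _ _ => erefl).

(** For [k = 0] this is convertible to [degree0 N], which starts the induction on degrees. *)
Definition at_degree (N : bornMod A) (k : int) : chainComplex A :=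
  graded_complex (fun n => if n == k then N else zero_mod A).

(** Matching on [n =P k] fixes the boolean test in the type of [at_degree] and, in the true branch,
    supplies the equation to transport along. *)
Definition to_at_degree M (n k : int) : bornHom (M n) (at_degree (M k) k n) :=
  match n =P k as r in reflect _ b
    return bornHom (M n) (if b then M k else zero_mod A) with
  | ReflectT e => hom_cast M e
  | ReflectF _ => hom_zero _ _
  end.

Definition of_at_degree M (n k : int) : bornHom (at_degree (M k) k n) (M n) :=
  match n =P k as r in reflect _ b
    return bornHom (if b then M k else zero_mod A) (M n) with
  | ReflectT e => hom_cast M (esym e)
  | ReflectF _ => hom_zero _ _
  end.

Lemma to_at_degreeK M n : cancel (to_at_degree M n n) (of_at_degree M n n).
Proof.
rewrite /to_at_degree /of_at_degree /= => x.
(* In the true branch [e : n = n] is [erefl], since equality proofs in [int] are unique. *)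
by move: (n =P n) => r; case: _ / r => // e; rewrite (eq_irrelevance e erefl).
Qed.

Lemma of_at_degreeK M n : cancel (of_at_degree M n n) (to_at_degree M n n).
Proof.
rewrite /to_at_degree /of_at_degree /= => x.
by move: (n =P n) x => r; case: _ / r => // e; rewrite (eq_irrelevance e erefl).
Qed.

Lemma at_degree_out (N : bornMod A) (k n : int) (x : at_degree N k n) :
  n <> k -> x = 0.
Proof. by move: x => /=; case: eqP => // _ x _; exact: thinmx0. Qed.

(** In degree [n] only the index [n] can carry a nonzero module, so the component there determines
    the family; at every other [k] both sides are zero. *)
Lemma to_of_at_degree M n (y : forall k, at_degree (M k) k n) k :
  to_at_degree M n k (of_at_degree M n n (y n)) = y k.
Proof.
have [->|/eqP nk] := eqVneq k n; first exact: of_at_degreeK.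
by rewrite [RHS]at_degree_out ?[LHS]at_degree_out// => /esym.
Qed.

Lemma graded_prod_iso M :
  ho_isomorphic (prod_complex (fun k => at_degree (M k) k)) (graded_complex M).
Proof.
pose X := prod_complex (fun k => at_degree (M k) k).
pose f n : bornHom (X n) (M n) :=
  hom_comp (of_at_degree M n n) (prod_pr (fun k => at_degree (M k) k n) n).
pose g n : bornHom (M n) (X n) := prod_lift (to_at_degree M n).
apply: (@zero_diff_iso X (graded_complex M) _ _ f g) => // n x.
  by apply/functional_extensionality_dep => k; exact: to_of_at_degree.
exact: to_at_degreeK.
Qed.

Lemma graded_sum_iso M :
  ho_isomorphic (sum_complex (fun k => at_degree (M k) k)) (graded_complex M).
Proof.
(* The singleton [[set n]] is the common finite support that [sum_lift] requires. *)
have out n k : ~ [set n] k -> forall x, to_at_degree M n k x = 0.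
  by move=> nk x; apply: at_degree_out => /esym.
pose X := sum_complex (fun k => at_degree (M k) k).
pose f n : bornHom (X n) (M n) :=
  hom_comp (of_at_degree M n n) (sum_pr (fun k => at_degree (M k) k n) n).
pose g n : bornHom (M n) (X n) := sum_lift (finite_set1 n) (out n).
apply: (@zero_diff_iso X (graded_complex M) _ _ f g) => // n x.
- by apply/val_inj/functional_extensionality_dep.
- by apply/val_inj/functional_extensionality_dep => k; exact: to_of_at_degree.
exact: to_at_degreeK.
Qed.

(** * The two cones over the cycles *)

Section Cycles.
Context (X : chainComplex A).

Definition cycles : chainComplex A :=
  graded_complex (fun n => ker_mod (cx_d X n)).

Fact cycles_incl_comm n (z : cycles n) :
  cx_d X n (ker_incl (cx_d X n) z) = ker_incl (cx_d X (n - 1)) (cx_d cycles n z).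
Proof. exact: ker_eq0. Qed.

Definition cycles_incl : chainMap cycles X :=
  @ChainMap _ _ cycles X (fun n => ker_incl (cx_d X n)) cycles_incl_comm.

Definition cycles_incl0 : chainMap cycles (graded_complex X) :=
  @ChainMap _ _ cycles (graded_complex X) (fun n => ker_incl (cx_d X n))
    (fun _ _ => erefl).

(** The differential with codomain restricted to the cycles, the first component of both cones in
    degree [n]; it is the off-diagonal entry of the shear. *)
Definition boundary n : bornHom (X n) (cycles (n - 1)) :=
  ker_lift (@cx_dd _ _ X n).

Definition cone_shear n :
    bornHom (cone cycles_incl n) (cone cycles_incl0 n) :=
  hom_pair (hom_add (hom_fst _ _) (hom_comp (boundary n) (hom_snd _ _)))
    (hom_snd _ _).

Definition cone_unshear n :
    bornHom (cone cycles_incl0 n) (cone cycles_incl n) :=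
  hom_pair (hom_add (hom_fst _ _) (hom_opp (hom_comp (boundary n) (hom_snd _ _))))
    (hom_snd _ _).

(** The differentials send [(z, x)] to [(0, z + d x)] in the cone of [cycles_incl] and to [(0, z)]
    in that of [cycles_incl0]. The shear accounts for the term [d x]; the leftover [d (z + d x)]
    vanishes because [z] is a cycle. *)
Fact cone_shear_comm n (x : cone cycles_incl n) :
  cx_d (cone cycles_incl0) n (cone_shear n x) =
  cone_shear (n - 1) (cx_d (cone cycles_incl) n x).
Proof.
case: x => z x; apply: pair_mod_eq.
  change (- 0 = - 0 + boundary (n - 1) (ker_val z + cx_d X n x)).
  rewrite oppr0 add0r; apply/val_inj.
  change (0 = cx_d X (n - 1) (ker_val z + cx_d X n x)).
  by rewrite linearD /= ker_eq0 cx_dd addr0.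
change (ker_val z + cx_d X n x + 0 = ker_val z + cx_d X n x).
by rewrite addr0.
Qed.

Fact cone_unshear_comm n (x : cone cycles_incl0 n) :
  cx_d (cone cycles_incl) n (cone_unshear n x) =
  cone_unshear (n - 1) (cx_d (cone cycles_incl0) n x).
Proof.
case: x => z x; apply: pair_mod_eq.
  change (- 0 = - 0 - boundary (n - 1) (ker_val z + 0)).
  rewrite oppr0 add0r addr0; apply/val_inj.
  change (0 = - cx_d X (n - 1) (ker_val z)).
  by rewrite ker_eq0 oppr0.
change (ker_val z - cx_d X n x + cx_d X n x = ker_val z + 0).
by rewrite subrK addr0.
Qed.

Lemma cone_cycles_iso :
  ho_isomorphic (cone cycles_incl0) (cone cycles_incl).
Proof.
apply: (@ho_isomorphic_can _ _ (ChainMap cone_unshear_comm)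
  (ChainMap cone_shear_comm)) => n [z x]; apply: pair_mod_eq => //.
  change (z - boundary n x + boundary n x = z); exact: subrK.
change (z + boundary n x - boundary n x = z); exact: addrK.
Qed.

End Cycles.

(** * Membership in the triangulated subcategory *)

Section Triangulated.
Context (T : chainComplex A -> Prop) (triT : triangulated_subcategory T).
Hypothesis T0 : forall N : bornMod A, T (degree0 N).

(** Induction on the integer [k] in both directions: [shift] raises the degree by one and [unshift]
    lowers it. Their signs are harmless on a zero differential. *)
Lemma tri_at_degree (N : bornMod A) k : T (at_degree N k).
Proof.
elim: k => [|k IHk|k IHk]; first exact: T0.
- apply: (tri_iso triT) (tri_shift triT IHk).
  apply: zero_diff_eq_iso => // [n x|n] /=; first exact: oppr0.
  by rewrite subr_eq -addn1 PoszD.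
- apply: (tri_iso triT) (tri_unshift triT IHk).
  apply: zero_diff_eq_iso => // [n x|n] /=.
    by rewrite /unshift_d /= /hom_opp_fun /= linear0 oppr0.
  by rewrite -addn1 PoszD opprD -subr_eq opprK.
Qed.

Lemma tri_graded :
  closed_under_direct_sums T \/ closed_under_direct_products T ->
  forall M, T (graded_complex M).
Proof.
move=> [Tsum|Tprod] M.
  by apply: (tri_iso triT (graded_sum_iso M)); apply: Tsum => k;
    exact: tri_at_degree.
by apply: (tri_iso triT (graded_prod_iso M)); apply: Tprod => k;
  exact: tri_at_degree.
Qed.

End Triangulated.

End Complexes.

Theorem proposition6 (R : realType) (A : bornAlg R) (T : chainComplex A -> Prop) :
  triangulated_subcategory T ->
  (forall M : bornMod A, T (degree0 M)) ->
  closed_under_direct_sums T \/ closed_under_direct_products T ->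
  forall X : chainComplex A, T X.
Proof.
move=> triT T0 Tcl X.
have gT := tri_graded triT T0 Tcl.
(* The clause kept is the one that puts the middle term [X] in [T] once the cycles and the cone are
   there. *)
have [_ _] := tri_third triT (cone_exact_triangle (cycles_incl X)).
apply; first exact: gT.
apply: (tri_iso triT (cone_cycles_iso X)).
(* Here the clause kept yields the cone from two complexes with zero differential. *)
have [+ _ _] := tri_third triT (cone_exact_triangle (cycles_incl0 X)).
by apply; exact: gT.
Qed.
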